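(* Let $m \neq n$ be non-zero rational numbers and let $E$ be the elliptic curve $W^2 = U(U-m)(U-n)$ over $\mathbb{Q}$, with group of rational points $E(\mathbb{Q})$. Suppose there exist four non-zero rational numbers $m_1, m_2, n_1, n_2$ such that $m_1 m_2 = m$, $n_1 n_2 = n$, $m_1 m_2 \neq n_1 n_2$ and $m_1 + m_2 = n_1 + n_2$. Then the set $\mathcal{P}(m,n) = \{\pm P_j : j = 1,2,3,4\}$, where $$P_1 = (m_1 n_1,\ (m_2 - n_1) m_1 n_1), \quad -P_1 = (m_1 n_1,\ -(m_2 - n_1) m_1 n_1),$$ $$P_2 = (m_1 n_2,\ (m_1 - n_1) m_1 n_2), \quad -P_2 = (m_1 n_2,\ -(m_1 - n_1) m_1 n_2),$$ $$P_3 = (m_2 n_1,\ (m_1 - n_1) m_2 n_1), \quad -P_3 = (m_2 n_1,\ -(m_1 - n_1) m_2 n_1),$$ $$P_4 = (m_2 n_2,\ (m_2 - n_1) m_2 n_2), \quad -P_4 = (m_2 n_2,\ -(m_2 - n_1) m_2 n_2),$$ is a subset of $E(\mathbb{Q})$.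
   Context: Points are written in affine coordinates $(U,W)$ on the curve $W^2 = U(U-m)(U-n)$. *)

(* Defs.v *)
From HB Require Import structures.
From mathcomp Require Import all_boot all_order all_algebra.

Set Implicit Arguments.
Unset Strict Implicit.
Unset Printing Implicit Defensive.

Import GRing.Theory.
Local Open Scope ring_scope.

(* [None] is the point at infinity, the neutral element of the group law;
   [Some (u, w)] is the affine point with coordinates (U, W) = (u, w). *)
Definition point : Type := option (rat * rat).

HB.instance Definition _ := Equality.on point.

Definition affine_point (u w : rat) : point := Some (u, w).

(* E(Q) for E : W^2 = U(U - m)(U - n). *)
Definition rational_points (m n : rat) : pred point :=
  fun P => if P is Some (u, w) then w ^+ 2 == u * (u - m) * (u - n) else true.

(* The inverse for the group law on E(Q), the equation having no W or UW term. *)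
Definition opp_point (P : point) : point :=
  if P is Some (u, w) then affine_point u (- w) else None.

Definition P1 (m1 m2 n1 n2 : rat) : point :=
  affine_point (m1 * n1) ((m2 - n1) * m1 * n1).
Definition P2 (m1 m2 n1 n2 : rat) : point :=
  affine_point (m1 * n2) ((m1 - n1) * m1 * n2).
Definition P3 (m1 m2 n1 n2 : rat) : point :=
  affine_point (m2 * n1) ((m1 - n1) * m2 * n1).
Definition P4 (m1 m2 n1 n2 : rat) : point :=
  affine_point (m2 * n2) ((m2 - n1) * m2 * n2).

(* The finite set P(m, n) = {P_j, - P_j : j = 1, 2, 3, 4}, with m = m1 m2 and
   n = n1 n2; it depends on the chosen factorizations, which are therefore
   explicit arguments. *)
Definition calP (m1 m2 n1 n2 : rat) : seq point :=
  [:: P1 m1 m2 n1 n2; opp_point (P1 m1 m2 n1 n2);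
      P2 m1 m2 n1 n2; opp_point (P2 m1 m2 n1 n2);
      P3 m1 m2 n1 n2; opp_point (P3 m1 m2 n1 n2);
      P4 m1 m2 n1 n2; opp_point (P4 m1 m2 n1 n2)].

(* Main.v *)
Require Import Defs.
From mathcomp Require Import all_boot all_order all_algebra.
From mathcomp Require Import ring.

Import GRing.Theory.
Local Open Scope ring_scope.

(** If [m1 + m2 = n1 + n2], then [m1 - n2 = n1 - m2], so at [U = m1 n1] the
    factors [U - m1 m2 = m1 (n1 - m2)] and [U - n1 n2 = n1 (m1 - n2)] share
    [n1 - m2], and the right-hand side of the curve equation is the square of
    [(m2 - n1) m1 n1] ([P1_rational]).  Exchanging [m1] with [m2], or [n1] with
    [n2], changes neither the curve nor the sum condition, and up to sign it
    carries [P1] to each of the other three points.  The signs are harmless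
    because negation preserves the curve ([opp_point_rational]). *)

Lemma opp_point_rational (m n : rat) (P : point) :
  P \in rational_points m n -> opp_point P \in rational_points m n.
Proof. by case: P => [[u w]|] //; rewrite /in_mem /= sqrrN. Qed.

Lemma P1_rational (m1 m2 n1 n2 : rat) : m1 + m2 = n1 + n2 ->
  P1 m1 m2 n1 n2 \in rational_points (m1 * m2) (n1 * n2).
Proof.
move=> hsum; have -> : n2 = m1 + m2 - n1 by rewrite hsum addrAC subrr add0r.
by apply/eqP; ring.
Qed.

(** The sum condition gives [m2 - n2 = - (m1 - n1)], hence the sign. *)
Lemma P2_opp_P1 (m1 m2 n1 n2 : rat) : m1 + m2 = n1 + n2 ->
  P2 m1 m2 n1 n2 = opp_point (P1 m1 m2 n2 n1).
Proof.
move=> hsum; have -> : n2 = m1 + m2 - n1 by rewrite hsum addrAC subrr add0r.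
by rewrite /P2 /P1 /=; congr (affine_point _ _); ring.
Qed.

Lemma P2_rational (m1 m2 n1 n2 : rat) : m1 + m2 = n1 + n2 ->
  P2 m1 m2 n1 n2 \in rational_points (m1 * m2) (n1 * n2).
Proof.
move=> hsum; rewrite (P2_opp_P1 _ _ _ _ hsum) (mulrC n1).
by apply/opp_point_rational/P1_rational; rewrite (addrC n2).
Qed.

Theorem theorem1 (m n : rat) (hm : m != 0) (hn : n != 0) (hmn : m != n)
  (m1 m2 n1 n2 : rat)
  (hm1 : m1 != 0) (hm2 : m2 != 0) (hn1 : n1 != 0) (hn2 : n2 != 0)
  (hm12 : m1 * m2 = m) (hn12 : n1 * n2 = n)
  (hne : m1 * m2 != n1 * n2) (hsum : m1 + m2 = n1 + n2) :
  {subset calP m1 m2 n1 n2 <= rational_points m n}.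
Proof.
rewrite -hm12 -hn12.
have E1 := P1_rational _ _ _ _ hsum.
have E2 := P2_rational _ _ _ _ hsum.
have hsum' : m2 + m1 = n1 + n2 by rewrite addrC.
(* [P3] is literally [P1] with [m1] and [m2] exchanged. *)
have E3 : P3 m1 m2 n1 n2 \in rational_points (m1 * m2) (n1 * n2).
  by rewrite (mulrC m1); exact: (P1_rational _ _ _ _ hsum').
(* [P4] is literally [P2] with [m1] and [m2] exchanged. *)
have E4 : P4 m1 m2 n1 n2 \in rational_points (m1 * m2) (n1 * n2).
  by rewrite (mulrC m1); exact: (P2_rational _ _ _ _ hsum').
move=> P; rewrite !in_cons in_nil orbF.
by do 7?[case/predU1P=> [->|]]; [..| move/eqP->];
  do ?apply: opp_point_rational.
Qed.
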